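(* Let $k$ be a field. If $\mathcal{H}=(H,\times,T_\times)$ is a GV-Hopf skew-brace over $k$, then $\mathrm{id}_H$ is a bijective $1$-cocycle of $H$ with values in $(H,\times,T_\times,\hookleftarrow)$, where $h\hookleftarrow l:=h_l:=hl_{(2)}\times T_\times(l_{(1)})$. Conversely, if $H$ is a Hopf algebra with bijective antipode and $\pi\colon H\to L$ is a bijective $1$-cocycle of $H$ with values in $(L,\times',T_{\times'},\hookleftarrow)$, then $(H,\times,T_\times)$ is a GV-Hopf skew-brace, where $h\times l:=\pi^{-1}\bigl(\pi(h)\times'\pi(l)\bigr)$ and $T_\times(h):=\pi^{-1}\bigl(T_{\times'}(\pi(h))\bigr)$.
   Context: All vector spaces, maps and tensor products are over $k$ (maps are linear); Sweedler notation is used; $\epsilon$ is the counit; $H^{\mathrm{cop}}$ is the opposite coalgebra. Multiplication in $H$ binds tighter than $\times$. GV-Hopf skew-brace: a tuple $(H,\times,T_\times)$ consisting of a Hopf algebra $H$ with bijective antipode $S$ and linear maps $\times\colon H\otimes H\to H$, $T_\times\colon H\to H$ such that: 1) $\times$ is associative with unity $1$ (the unit of $H$); 2) $(m\times l)h=mh_{(3)}\times T_\times(h_{(2)})\times lh_{(1)}$ for all $h,m,l\in H$; 3) $h\otimes m\mapsto(m_{(1)}\times h)S(m_{(2)})$ is a coalgebra morphism from $H\otimes H^{\mathrm{cop}}$ to $H$; 4) $h\otimes m\mapsto(h\times m_{(2)})S^{-1}(m_{(1)})$ is a coalgebra morphism from $H\otimes H^{\mathrm{cop}}$ to $H$. Bijective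 $1$-cocycles: let $H$ be a Hopf algebra with bijective antipode and let $(L,\times',T_{\times'},\hookleftarrow)$ be a coalgebra $L$ endowed with a binary operation $\times'\colon L\otimes L\to L$, a map $T_{\times'}\colon L\to L$ and a right action $\hookleftarrow\colon L\otimes H\to L$ such that: $\times'$ is associative with unit $1_L$; $T_{\times'}$ is the inverse of $\mathrm{id}$ for the convolution product of $\mathrm{End}_k(L)$ built from the opposite comultiplication of $L$ and $\times'$ (that is, $l_{(2)}\times'T_{\times'}(l_{(1)})=T_{\times'}(l_{(2)})\times'l_{(1)}=\epsilon(l)1_L$); $L$ is a right $H$-module coalgebra via $\hookleftarrow$; and $(m\times'l)\hookleftarrow h=(m\hookleftarrow h_{(2)})\times'(l\hookleftarrow h_{(1)})$ for all $m,l\in L$, $h\in H$. A bijective $1$-cocycle of $H$ with values in $(L,\times',T_{\times'},\hookleftarrow)$ is a coalgebra isomorphism $\pi\colon H\to L$ such that (i) $L$ is a right $H$-module coalgebra via $l\otimes h\mapsto T_{\times'}(\pi(h_{(3)}))\times'(l\hookleftarrow h_{(2)})\times'\pi(h_{(1)})$; (ii) $\pi(hm)=(\pi(h)\hookleftarrow m_{(2)})\times'\pi(m_{(1)})$ for all $h,m\in H$. *)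

(* Defs.v *)
From HB Require Import structures.
From mathcomp Require Import all_boot all_order all_algebra.
From mathcomp Require Import boolp.

Set Implicit Arguments.
Unset Strict Implicit.
Unset Printing Implicit Defensive.

Import GRing.Theory.
Local Open Scope ring_scope.
Local Open Scope quotient_scope.

Reserved Notation "x ⊗ y" (at level 45, left associativity).
Reserved Notation "C ^cop" (at level 1, format "C ^cop").

(* Tensor product over a field, with no finiteness assumption: a finite list   *)
(* [:: (u1, v1); ...; (un, vn)] stands for u1 ⊗ v1 + ... + un ⊗ vn, and two   *)
(* lists are identified when every bilinear map takes the same value on them. *)
(* The universal property is bilinear_tens, tfold_linear, tfold_tens and      *)
(* eq_linear_tens below.                                                      *)

Section TensorType.
Variables (k : fieldType) (U V : lmodType k).

Definition teval (W : nmodType) (f : U -> V -> W) (s : seq (U * V)) : W :=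
  \sum_(p <- s) f p.1 p.2.

Definition tensor_rel (s t : seq (U * V)) : bool :=
  `[< forall (W : lmodType k) (f : U -> V -> W),
        bilinear_for *:%R *:%R f -> teval f s = teval f t >].

Fact tensor_rel_refl : reflexive tensor_rel.
Proof. by move=> s; apply/asboolP. Qed.

Fact tensor_rel_sym : symmetric tensor_rel.
Proof.
by move=> s t; apply/asboolP/asboolP => H W f bf; rewrite H.
Qed.

Fact tensor_rel_trans : transitive tensor_rel.
Proof.
move=> s t r /asboolP H1 /asboolP H2; apply/asboolP => W f bf.
by rewrite H1 // H2.
Qed.

Canonical tensor_equiv :=
  EquivRel tensor_rel tensor_rel_refl tensor_rel_sym tensor_rel_trans.

Definition tensor := {eq_quot tensor_equiv}.

HB.instance Definition _ := Choice.on tensor.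
HB.instance Definition _ := EqQuotient.on tensor.

Definition tens (u : U) (v : V) : tensor := \pi_tensor [:: (u, v)].

(* The value at t of the linear map induced by a bilinear f, computed from an *)
(* arbitrary decomposition of t as a sum of pure tensors; only meaningful     *)
(* when f is bilinear.                                                        *)
Definition tfold (W : nmodType) (f : U -> V -> W) (t : tensor) : W :=
  teval f (repr t).

Lemma tfold_pi (W : lmodType k) (f : U -> V -> W) s :
  bilinear_for *:%R *:%R f -> tfold f (\pi_tensor s) = teval f s.
Proof.
move=> bf; rewrite /tfold.
have /eqmodP/asboolP H : repr (\pi_tensor s) = s %[mod tensor].
  by rewrite reprK.
exact: H.
Qed.

Lemma tensor_ext (s t : tensor) :
  (forall (W : lmodType k) (f : U -> V -> W),
     bilinear_for *:%R *:%R f -> tfold f s = tfold f t) -> s = t.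
Proof.
move=> H; rewrite -[s]reprK -[t]reprK; apply/eqmodP/asboolP => W f bf.
exact: H.
Qed.

Lemma tfold_tens (W : lmodType k) (f : U -> V -> W) u v :
  bilinear_for *:%R *:%R f -> tfold f (tens u v) = f u v.
Proof. by move=> bf; rewrite tfold_pi // /teval big_seq1. Qed.

Definition tensor_zero : tensor := \pi_tensor [::].
Definition tensor_add (s t : tensor) : tensor :=
  \pi_tensor (repr s ++ repr t).
Definition tensor_scale (a : k) (s : tensor) : tensor :=
  \pi_tensor [seq (a *: p.1, p.2) | p <- repr s].
Definition tensor_opp (s : tensor) : tensor := tensor_scale (- 1) s.

Section Fold.
Variables (W : lmodType k) (f : U -> V -> W).
Hypothesis bf : bilinear_for *:%R *:%R f.

Fact tfold_zero : tfold f tensor_zero = 0.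
Proof. by rewrite tfold_pi // /teval big_nil. Qed.

Fact tfold_add s t : tfold f (tensor_add s t) = tfold f s + tfold f t.
Proof. by rewrite tfold_pi // /teval big_cat. Qed.

Fact tfold_scale a s : tfold f (tensor_scale a s) = a *: tfold f s.
Proof.
rewrite tfold_pi // /tfold /teval big_map scaler_sumr; apply: eq_bigr => p _ /=.
exact: (scalable_linear (bf.1 _)).
Qed.
End Fold.

Fact tensor_addA : associative tensor_add.
Proof.
by move=> r s t; apply: tensor_ext => W f bf; rewrite !tfold_add // addrA.
Qed.

Fact tensor_addC : commutative tensor_add.
Proof.
by move=> s t; apply: tensor_ext => W f bf; rewrite !tfold_add // addrC.
Qed.

Fact tensor_add0 : left_id tensor_zero tensor_add.
Proof.
move=> s; apply: tensor_ext => W f bf.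
by rewrite tfold_add // tfold_zero // add0r.
Qed.

Fact tensor_addN : left_inverse tensor_zero tensor_opp tensor_add.
Proof.
move=> s; apply: tensor_ext => W f bf.
by rewrite tfold_add // tfold_zero // tfold_scale // scaleN1r addNr.
Qed.

HB.instance Definition _ :=
  GRing.isZmodule.Build tensor tensor_addA tensor_addC tensor_add0 tensor_addN.

Lemma tfoldD (W : lmodType k) (f : U -> V -> W) (s t : tensor) :
  bilinear_for *:%R *:%R f -> tfold f (s + t) = tfold f s + tfold f t.
Proof. by move=> bf; exact: (tfold_add bf). Qed.

Fact tensor_scaleA a b s :
  tensor_scale a (tensor_scale b s) = tensor_scale (a * b) s.
Proof. by apply: tensor_ext => W f bf; rewrite !tfold_scale // scalerA. Qed.

Fact tensor_scale1 : left_id 1 tensor_scale.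
Proof.
by move=> s; apply: tensor_ext => W f bf; rewrite tfold_scale // scale1r.
Qed.

Fact tensor_scaleDr : right_distributive tensor_scale +%R.
Proof.
move=> a s t; apply: tensor_ext => W f bf.
by rewrite tfoldD // !tfold_scale // tfoldD // scalerDr.
Qed.

Fact tensor_scaleDl s : {morph tensor_scale^~ s : a b / a + b}.
Proof.
move=> a b; apply: tensor_ext => W f bf.
by rewrite tfoldD // !tfold_scale // scalerDl.
Qed.

HB.instance Definition _ :=
  GRing.Zmodule_isLmodule.Build k tensor
    tensor_scaleA tensor_scale1 tensor_scaleDr tensor_scaleDl.

Lemma tfold_linear (W : lmodType k) (f : U -> V -> W) :
  bilinear_for *:%R *:%R f -> linear (tfold f).
Proof. by move=> bf a s t; rewrite tfoldD // (tfold_scale bf). Qed.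

Lemma bilinear_tens : bilinear_for *:%R *:%R tens.
Proof.
split=> [v|u] a x y; apply: tensor_ext => W f bf;
  rewrite (tfold_linear bf) !tfold_tens //.
- exact: bf.1.
- exact: bf.2.
Qed.

Lemma tensor_sum (t : tensor) : t = \sum_(p <- repr t) tens p.1 p.2.
Proof.
rewrite -[RHS]/(tfold tens t); apply: tensor_ext => W f bf.
have fD : {morph tfold f : s r / s + r} by move=> s r; exact: tfoldD.
have f0 : tfold f 0 = 0 by exact: tfold_zero.
rewrite [X in _ = tfold f X]/tfold /teval (big_morph _ fD f0).
by apply: eq_bigr => p _; rewrite tfold_tens.
Qed.

End TensorType.

Notation "U ⊗ V" := (tensor U%type V%type) : type_scope.
Notation "u ⊗ v" := (tens u v) : ring_scope.

Section TensorTheory.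
Variable k : fieldType.
Implicit Types U V W X : lmodType k.

Lemma linear_sum_fun U V (g : U -> V) I (s : seq I) (F : I -> U) :
  linear g -> g (\sum_(i <- s) F i) = \sum_(i <- s) g (F i).
Proof.
move=> lg.
have gD : {morph g : a b / a + b}.
  by move=> a b; rewrite -{1}[a]scale1r lg scale1r.
have g0 : g 0 = 0 by apply: (addrI (g 0)); rewrite -gD !addr0.
exact: big_morph.
Qed.

Lemma linear_tfold U V W X (g : W -> X) (f : U -> V -> W) (t : U ⊗ V) :
  linear g -> g (tfold f t) = tfold (fun u v => g (f u v)) t.
Proof. exact: linear_sum_fun. Qed.

Lemma eq_tfold U V (W : nmodType) (f g : U -> V -> W) (t : U ⊗ V) :
  (forall u v, f u v = g u v) -> tfold f t = tfold g t.
Proof. by move=> e; apply: eq_bigr. Qed.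

Lemma eq_linear_tens U V W (f g : U ⊗ V -> W) :
  linear f -> linear g -> (forall u v, f (u ⊗ v) = g (u ⊗ v)) -> f =1 g.
Proof.
move=> lf lg e t; rewrite (tensor_sum t) !linear_sum_fun //.
by apply: eq_bigr.
Qed.

Lemma tfold_id U V (t : U ⊗ V) : tfold (@tens k U V) t = t.
Proof. by rewrite {2}(tensor_sum t). Qed.

Lemma exchange_tfold U V (U' V' W : lmodType k) (f : U -> V -> U' -> V' -> W)
    (s : U ⊗ V) (t : U' ⊗ V') :
  tfold (fun u v => tfold (f u v) t) s =
  tfold (fun u' v' => tfold (fun u v => f u v u' v') s) t.
Proof. exact: exchange_big. Qed.

Lemma linear_tfold_param U V W X (f : X -> U -> V -> W) (t : U ⊗ V) :
  (forall u v, linear (fun x => f x u v)) -> linear (fun x => tfold (f x) t).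
Proof.
move=> lf a x y; rewrite /tfold /teval scaler_sumr -big_split.
by apply: eq_bigr => p _; exact: lf.
Qed.

Lemma linear_tfold_comp U V W X (f : U -> V -> W) (g : X -> U ⊗ V) :
  bilinear_for *:%R *:%R f -> linear g -> linear (fun x => tfold f (g x)).
Proof. by move=> bf lg a x y; rewrite lg tfold_linear. Qed.

Lemma linear_tensl U V X (g : X -> U) (v : V) :
  linear g -> linear (fun x => g x ⊗ v).
Proof. by move=> lg a x y; rewrite lg (bilinear_tens _ _).1. Qed.

Lemma linear_tensr U V X (u : U) (g : X -> V) :
  linear g -> linear (fun x => u ⊗ g x).
Proof. by move=> lg a x y; rewrite lg (bilinear_tens _ _).2. Qed.

Lemma tensZl U V a (u : U) (v : V) : (a *: u) ⊗ v = a *: (u ⊗ v).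
Proof. exact: (scalable_linear ((bilinear_tens U V).1 v)). Qed.

Lemma tensZr U V a (u : U) (v : V) : u ⊗ (a *: v) = a *: (u ⊗ v).
Proof. exact: (scalable_linear ((bilinear_tens U V).2 u)). Qed.

Lemma linear_idfun U : linear (fun x : U => x).
Proof. by []. Qed.

Lemma linear_scalel U X (g : X -> k) (u : U) :
  linear (g : X -> k^o) -> linear (fun x => g x *: u).
Proof. by move=> lg a x y; rewrite lg scalerDl scalerA. Qed.

Lemma linear_scaler U X (c : k) (g : X -> U) :
  linear g -> linear (fun x => c *: g x).
Proof. by move=> lg a x y; rewrite lg scalerDr !scalerA mulrC. Qed.

Lemma linear_comp_fun U V W (g : V -> W) (f : U -> V) :
  linear g -> linear f -> linear (fun x => g (f x)).
Proof. by move=> lg lf a x y; rewrite lf lg. Qed.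

End TensorTheory.

Ltac lin_solve :=
  repeat first
    [ assumption
    | exact: linear_idfun
    | (apply: linear_tensl => //)
    | (apply: linear_tensr => //)
    | (apply: linear_scalel => //)
    | (apply: linear_scaler => //)
    | (apply: linear_tfold_param => ? ?)
    | (apply: linear_tfold_comp; [split=> ? /= | ]) ].

Ltac bilin_solve := split=> ? /=; lin_solve.

Section TensorMaps.
Variable k : fieldType.
Implicit Types U V W : lmodType k.

(* f ⊗ g *)
Definition tmap U V (U' V' : lmodType k) (f : U -> U') (g : V -> V') :
  U ⊗ V -> U' ⊗ V' := tfold (fun u v => f u ⊗ g v).

Definition tswap U V : U ⊗ V -> V ⊗ U := tfold (fun u v => v ⊗ u).

Definition tassoc U V W : (U ⊗ V) ⊗ W -> U ⊗ (V ⊗ W) :=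
  tfold (fun t w => tfold (fun u v => u ⊗ (v ⊗ w)) t).

Lemma bilinear_tmap U V (U' V' : lmodType k) (f : U -> U') (g : V -> V') :
  linear f -> linear g ->
  bilinear_for *:%R *:%R (fun u v => f u ⊗ g v : (U' ⊗ V')%type).
Proof. by move=> lf lg; bilin_solve. Qed.

Lemma tmap_linear U V (U' V' : lmodType k) (f : U -> U') (g : V -> V') :
  linear f -> linear g -> linear (tmap f g).
Proof. by move=> lf lg; apply/tfold_linear/bilinear_tmap. Qed.

Lemma tmap_tens U V (U' V' : lmodType k) (f : U -> U') (g : V -> V') u v :
  linear f -> linear g -> tmap f g (u ⊗ v) = f u ⊗ g v.
Proof. by move=> lf lg; rewrite /tmap tfold_tens //; exact: bilinear_tmap. Qed.

Lemma tswap_linear U V : linear (@tswap U V).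
Proof. by apply: tfold_linear; bilin_solve. Qed.

Lemma tswap_tens U V (u : U) (v : V) : tswap (u ⊗ v) = v ⊗ u.
Proof. by rewrite /tswap tfold_tens //; bilin_solve. Qed.

Lemma bilinear_tassoc U V W :
  bilinear_for *:%R *:%R
    (fun (t : U ⊗ V) (w : W) => tfold (fun u v => u ⊗ (v ⊗ w)) t).
Proof. by split=> [w|t]; [apply: tfold_linear; bilin_solve|lin_solve]. Qed.

Lemma tassoc_linear U V W : linear (@tassoc U V W).
Proof. exact/tfold_linear/bilinear_tassoc. Qed.

Lemma tassoc_tens U V W (t : U ⊗ V) (w : W) :
  tassoc (t ⊗ w) = tfold (fun u v => u ⊗ (v ⊗ w)) t.
Proof. by rewrite /tassoc tfold_tens //; exact: bilinear_tassoc. Qed.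

End TensorMaps.

HB.mixin Record isCoalgebra (k : fieldType) C of GRing.Lmodule k C := {
  comul : C -> (C ⊗ C)%type;
  counit : C -> k;
  comul_linear : linear comul;
  counit_linear : scalar counit;
  comulA : forall c : C,
    tassoc (tmap comul id (comul c)) = tmap id comul (comul c);
  counitl : forall c : C, tfold (fun c1 c2 => counit c1 *: c2) (comul c) = c;
  counitr : forall c : C, tfold (fun c1 c2 => counit c2 *: c1) (comul c) = c
}.

#[short(type="coalgType")]
HB.structure Definition Coalgebra (k : fieldType) :=
  { C of isCoalgebra k C & GRing.Lmodule k C }.

(* Sweedler notation: sw2 c (fun c1 c2 => F c1 c2) is F applied to            *)
(* c_(1) ⊗ c_(2), and sw3 is its analogue for c_(1) ⊗ c_(2) ⊗ c_(3).          *)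
Definition sw2 (k : fieldType) (C : coalgType k) (W : nmodType)
    (c : C) (F : C -> C -> W) : W := tfold F (comul c).

Definition sw3 (k : fieldType) (C : coalgType k) (W : nmodType)
    (c : C) (F : C -> C -> C -> W) : W :=
  sw2 c (fun c12 c3 => sw2 c12 (fun c1 c2 => F c1 c2 c3)).

Definition is_coalgebra_morphism (k : fieldType) (C D : coalgType k)
    (f : C -> D) : Prop :=
  [/\ linear f,
      forall c, comul (f c) = tmap f f (comul c)
    & forall c, counit (f c) = counit c].

Definition is_coalgebra_isomorphism (k : fieldType) (C D : coalgType k)
    (f : C -> D) : Prop := is_coalgebra_morphism f /\ bijective f.

Ltac lin_solve ::=
  repeat first
    [ assumption
    | exact: linear_idfun
    | exact: comul_linear
    | exact: counit_linear
    | (apply: linear_tensl => //)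
    | (apply: linear_tensr => //)
    | (apply: linear_scalel => //)
    | (apply: linear_scaler => //)
    | (apply: linear_tfold_param => ? ?)
    | (apply: linear_tfold_comp; [split=> ? /= | ]) ].

Section CoalgebraTheory.
Variables (k : fieldType) (C : coalgType k).

Lemma sw3_coassoc (W : lmodType k) (F : C -> C -> C -> W) (c : C) :
  (forall y z, linear (fun x => F x y z)) ->
  (forall x z, linear (fun y => F x y z)) ->
  (forall x y, linear (F x y)) ->
  sw3 c F = sw2 c (fun c1 c23 => sw2 c23 (fun c2 c3 => F c1 c2 c3)).
Proof.
move=> F1 F2 F3.
have bF x : bilinear_for *:%R *:%R (F x) by split=> ?; [exact: F2|exact: F3].
pose G := fun x t => tfold (F x) t.
have bG : bilinear_for *:%R *:%R G.
  split=> [t|x]; last exact: tfold_linear.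
  by apply: linear_tfold_param => y z; exact: F1.
have lG := tfold_linear bG.
have lid : linear (@id C) by [].
have /(congr1 (tfold G)) := comulA c.
rewrite {1}/tmap (linear_tfold _ _ (@tassoc_linear _ _ _ _)) [in RHS]/tmap.
rewrite !(linear_tfold _ (comul c) lG) /sw3 /sw2 => E.
transitivity (tfold (fun u v => tfold G (u ⊗ comul v)) (comul c)); last first.
  by apply: eq_tfold => u v; rewrite tfold_tens.
rewrite -E; apply: eq_tfold => u v; rewrite tassoc_tens linear_tfold //.
by apply: eq_tfold => x y; rewrite tfold_tens // /G tfold_tens.
Qed.

End CoalgebraTheory.

Section TensorCoalgebra.
Variables (k : fieldType) (C D : coalgType k).

Definition tensor_comul (t : C ⊗ D) : (C ⊗ D) ⊗ (C ⊗ D) :=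
  tfold (fun c d =>
    sw2 c (fun c1 c2 => sw2 d (fun d1 d2 => (c1 ⊗ d1) ⊗ (c2 ⊗ d2)))) t.

Definition tensor_counit (t : C ⊗ D) : k :=
  tfold (fun c d => counit c * counit d) t.

Fact bilinear_tensor_comul : bilinear_for *:%R *:%R (fun (c : C) (d : D) =>
  sw2 c (fun c1 c2 => sw2 d (fun d1 d2 => (c1 ⊗ d1) ⊗ (c2 ⊗ d2)))).
Proof. by rewrite /sw2; bilin_solve. Qed.

Fact bilinear_tensor_counit :
  bilinear_for *:%R *:%R (fun (c : C) (d : D) => counit c * counit d : k^o).
Proof.
split=> [d|c] a x y; rewrite counit_linear.
- by rewrite mulrDl -mulrA.
- by rewrite mulrDr mulrCA.
Qed.

Fact tensor_comul_linear : linear tensor_comul.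
Proof. exact/tfold_linear/bilinear_tensor_comul. Qed.

Fact tensor_counit_linear : scalar tensor_counit.
Proof. exact: (tfold_linear bilinear_tensor_counit). Qed.

Lemma tensor_comul_tens c d : tensor_comul (c ⊗ d) =
  sw2 c (fun c1 c2 => sw2 d (fun d1 d2 => (c1 ⊗ d1) ⊗ (c2 ⊗ d2))).
Proof. exact: (tfold_tens _ _ bilinear_tensor_comul). Qed.

Lemma tensor_counit_tens c d : tensor_counit (c ⊗ d) = counit c * counit d.
Proof. exact: (tfold_tens _ _ bilinear_tensor_counit). Qed.

Fact tensor_comulA t :
  tassoc (tmap tensor_comul id (tensor_comul t)) =
  tmap id tensor_comul (tensor_comul t).
Proof.
have lid : linear (@id (C ⊗ D)) by [].
have lc := tensor_comul_linear.
move: t; apply: eq_linear_tens.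
- apply: linear_comp_fun; first exact: tassoc_linear.
  by apply: linear_comp_fun => //; exact: tmap_linear.
- by apply: linear_comp_fun => //; exact: tmap_linear.
move=> c d; rewrite tensor_comul_tens.
rewrite (linear_tfold _ _ (tmap_linear lc lid)).
rewrite (linear_tfold _ _ (tmap_linear lid lc)).
rewrite (linear_tfold _ _ (@tassoc_linear _ _ _ _)).
transitivity (sw3 c (fun c1 c2 c3 => sw3 d (fun d1 d2 d3 =>
  (c1 ⊗ d1) ⊗ ((c2 ⊗ d2) ⊗ (c3 ⊗ d3))))).
  apply: eq_tfold => c12 c3.
  rewrite (linear_tfold _ _ (tmap_linear lc lid)).
  rewrite (linear_tfold _ _ (@tassoc_linear _ _ _ _)).
  rewrite /sw3 /sw2 [RHS]exchange_tfold.
  apply: eq_tfold => d12 d3.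
  rewrite tmap_tens // tassoc_tens tensor_comul_tens.
  have lA : linear (fun t : (C ⊗ D) ⊗ (C ⊗ D) =>
      tfold (fun u v => u ⊗ (v ⊗ (c3 ⊗ d3))) t).
    by apply: tfold_linear; bilin_solve.
  rewrite (linear_tfold _ _ lA).
  apply: eq_tfold => c1 c2; rewrite (linear_tfold _ _ lA).
  by apply: eq_tfold => d1 d2; rewrite tfold_tens //; bilin_solve.
rewrite sw3_coassoc; try by move=> *; rewrite /sw3 /sw2; lin_solve.
apply: eq_tfold => c1 c23.
rewrite (linear_tfold _ _ (tmap_linear lid lc)).
transitivity (sw2 c23 (fun c2 c3 => sw2 d (fun d1 d23 => sw2 d23 (fun d2 d3 =>
  (c1 ⊗ d1) ⊗ ((c2 ⊗ d2) ⊗ (c3 ⊗ d3)))))).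
  apply: eq_tfold => c2 c3; rewrite sw3_coassoc //;
    by move=> *; lin_solve.
rewrite /sw2 [LHS]exchange_tfold; apply: eq_tfold => d1 d23.
rewrite tmap_tens // tensor_comul_tens.
have lA : linear (tens (c1 ⊗ d1) : (C ⊗ D) ⊗ (C ⊗ D) -> _).
  by move=> a x y; rewrite (bilinear_tens _ _).2.
rewrite [in RHS](linear_tfold _ _ lA).
by apply: eq_tfold => c2 c3; rewrite [in RHS](linear_tfold _ _ lA).
Qed.

Fact tensor_counitl t :
  tfold (fun t1 t2 => tensor_counit t1 *: t2) (tensor_comul t) = t.
Proof.
have bf : bilinear_for *:%R *:%R
    (fun t1 t2 : C ⊗ D => tensor_counit t1 *: t2).
  have l := tensor_counit_linear.
  by split=> ? /=; lin_solve.
have lf := tfold_linear bf.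
move: t; apply: eq_linear_tens => [|//|c d].
  by apply: linear_comp_fun => //; exact: tensor_comul_linear.
rewrite tensor_comul_tens (linear_tfold _ _ lf) -{2}[c]counitl.
have l1 : linear (fun c => c ⊗ d : (C ⊗ D)%type) by lin_solve.
rewrite (linear_tfold _ _ l1); apply: eq_tfold => c1 c2.
rewrite (linear_tfold _ _ lf) -{2}[d]counitl.
have l2 : linear (tens (counit c1 *: c2) : D -> (C ⊗ D)%type).
  by move=> a x y; rewrite (bilinear_tens _ _).2.
rewrite (linear_tfold _ _ l2); apply: eq_tfold => d1 d2.
rewrite tfold_tens // tensor_counit_tens.
by rewrite tensZl tensZr scalerA.
Qed.

Fact tensor_counitr t :
  tfold (fun t1 t2 => tensor_counit t2 *: t1) (tensor_comul t) = t.
Proof.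
have bf : bilinear_for *:%R *:%R
    (fun t1 t2 : C ⊗ D => tensor_counit t2 *: t1).
  have l := tensor_counit_linear.
  by split=> ? /=; lin_solve.
have lf := tfold_linear bf.
move: t; apply: eq_linear_tens => [|//|c d].
  by apply: linear_comp_fun => //; exact: tensor_comul_linear.
rewrite tensor_comul_tens (linear_tfold _ _ lf) -{2}[c]counitr.
have l1 : linear (fun c => c ⊗ d : (C ⊗ D)%type) by lin_solve.
rewrite (linear_tfold _ _ l1); apply: eq_tfold => c1 c2.
rewrite (linear_tfold _ _ lf) -{2}[d]counitr.
have l2 : linear (tens (counit c2 *: c1) : D -> (C ⊗ D)%type).
  by move=> a x y; rewrite (bilinear_tens _ _).2.
rewrite (linear_tfold _ _ l2); apply: eq_tfold => d1 d2.
rewrite tfold_tens // tensor_counit_tens.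
by rewrite tensZl tensZr scalerA.
Qed.

HB.instance Definition _ := isCoalgebra.Build k (C ⊗ D)%type
  tensor_comul_linear tensor_counit_linear
  tensor_comulA tensor_counitl tensor_counitr.

End TensorCoalgebra.

(* C^cop has the carrier of C but the flipped comultiplication, so            *)
(* sw2 (of_cop m) is Sweedler notation for the comultiplication of C itself.  *)
Definition cop (T : Type) : Type := T.
Notation "C ^cop" := (cop C) : type_scope.
Definition of_cop (T : Type) (x : T^cop) : T := x.

Section Cop.
Variables (k : fieldType) (C : coalgType k).

HB.instance Definition _ := GRing.Lmodule.on C^cop.

Definition cop_comul (c : C^cop) : C^cop ⊗ C^cop := tswap (comul (of_cop c)).
Definition cop_counit (c : C^cop) : k := counit (of_cop c).

Fact cop_comul_linear : linear cop_comul.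
Proof. exact: (linear_comp_fun (@tswap_linear _ C C) comul_linear). Qed.

Fact cop_counit_linear : scalar cop_counit.
Proof. exact: (@counit_linear k C). Qed.

Fact cop_comulA c :
  tassoc (tmap cop_comul id (cop_comul c)) = tmap id cop_comul (cop_comul c).
Proof.
have lid : linear (@id C^cop) by [].
have lc := cop_comul_linear.
rewrite (linear_tfold _ _ (tmap_linear lc lid)).
rewrite (linear_tfold _ _ (tmap_linear lid lc)).
rewrite (linear_tfold _ _ (@tassoc_linear _ _ _ _)).
transitivity (sw2 (of_cop c) (fun c3 c12 => sw2 c12 (fun c2 c1 =>
   (c1 : C^cop) ⊗ ((c2 : C^cop) ⊗ (c3 : C^cop))))).
  apply: eq_tfold => c3 c12; rewrite tmap_tens // tassoc_tens.
  rewrite linear_tfold; last by apply: tfold_linear; bilin_solve.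
  by apply: eq_tfold => c2 c1; rewrite tfold_tens //; bilin_solve.
rewrite -(@sw3_coassoc k C _ (fun c3 c2 c1 =>
   (c1 : C^cop) ⊗ ((c2 : C^cop) ⊗ (c3 : C^cop)))); try by move=> *; lin_solve.
apply: eq_tfold => c23 c1; rewrite tmap_tens //.
have lA : linear (tens (c1 : C^cop) : (C^cop ⊗ C^cop) -> _).
  by move=> a x y; rewrite (bilinear_tens _ _).2.
by rewrite (linear_tfold _ _ lA).
Qed.

Fact cop_counitl c :
  tfold (fun c1 c2 => cop_counit c1 *: c2) (cop_comul c) = c.
Proof.
rewrite linear_tfold; last first.
  have l := cop_counit_linear.
  by apply: tfold_linear; bilin_solve.
rewrite -[RHS](@counitr k C); apply: eq_tfold => c1 c2.
by rewrite tfold_tens //; have l := cop_counit_linear; bilin_solve.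
Qed.

Fact cop_counitr c :
  tfold (fun c1 c2 => cop_counit c2 *: c1) (cop_comul c) = c.
Proof.
rewrite linear_tfold; last first.
  have l := cop_counit_linear.
  by apply: tfold_linear; bilin_solve.
rewrite -[RHS](@counitl k C); apply: eq_tfold => c1 c2.
by rewrite tfold_tens //; have l := cop_counit_linear; bilin_solve.
Qed.

HB.instance Definition _ := isCoalgebra.Build k C^cop
  cop_comul_linear cop_counit_linear cop_comulA cop_counitl cop_counitr.

End Cop.

(* An algType is a nonzero ring, which excludes no Hopf algebra: the counit   *)
(* sends 1 to 1 in k.                                                         *)
HB.mixin Record isHopf (k : fieldType) H
    of GRing.Algebra k H & Coalgebra k H := {
  comul1 : comul (1 : H) = 1 ⊗ 1;
  comulM : forall g h : H, comul (g * h) =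
    sw2 g (fun g1 g2 => sw2 h (fun h1 h2 => (g1 * h1) ⊗ (g2 * h2)));
  counit1 : counit (1 : H) = 1;
  counitM : forall g h : H, counit (g * h) = counit g * counit h;
  antipode : H -> H;
  antipode_linear : linear antipode;
  antipodel : forall h : H, sw2 h (fun h1 h2 => antipode h1 * h2) = (counit h)%:A;
  antipoder : forall h : H, sw2 h (fun h1 h2 => h1 * antipode h2) = (counit h)%:A
}.

#[short(type="hopfAlgType")]
HB.structure Definition HopfAlgebra (k : fieldType) :=
  { H of isHopf k H & GRing.Algebra k H & Coalgebra k H }.

HB.mixin Record hasBijectiveAntipode (k : fieldType) H of HopfAlgebra k H := {
  antipodeV : H -> H;
  antipodeK : cancel (antipode : H -> H) antipodeV;
  antipodeVK : cancel antipodeV (antipode : H -> H)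
}.

#[short(type="bijHopfAlgType")]
HB.structure Definition BijHopfAlgebra (k : fieldType) :=
  { H of hasBijectiveAntipode k H & HopfAlgebra k H }.

Definition is_right_module (k : fieldType) (L : lmodType k) (H : algType k)
    (act : L ⊗ H -> L) : Prop :=
  [/\ linear act,
      forall l, act (l ⊗ 1) = l
    & forall l h g, act (l ⊗ (h * g)) = act (act (l ⊗ h) ⊗ g)].

Definition is_right_module_coalgebra (k : fieldType) (L : coalgType k)
    (H : hopfAlgType k) (act : L ⊗ H -> L) : Prop :=
  is_right_module act /\ is_coalgebra_morphism act.

Definition is_unital_associative (k : fieldType) (L : lmodType k)
    (times : L ⊗ L -> L) (one : L) : Prop :=
  [/\ forall x y z, times (times (x ⊗ y) ⊗ z) = times (x ⊗ times (y ⊗ z)),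
      forall x, times (one ⊗ x) = x
    & forall x, times (x ⊗ one) = x].

Section SkewBraceAndCocycle.
Variable k : fieldType.

Record is_GV_Hopf_skew_brace (H : bijHopfAlgType k)
    (times : H ⊗ H -> H) (T : H -> H) : Prop := {
  gv_times_linear : linear times;
  gv_T_linear : linear T;
  gv_times_monoid : is_unital_associative times 1;
  gv_compat : forall h m l : H,
    times (m ⊗ l) * h =
    sw3 h (fun h1 h2 h3 => times (times (m * h3 ⊗ T h2) ⊗ (l * h1)));
  gv_morphism_left : is_coalgebra_morphism (fun t : H ⊗ H^cop =>
    tfold (fun (h : H) (m : H^cop) =>
      sw2 (of_cop m) (fun m1 m2 => times (m1 ⊗ h) * antipode m2)) t);
  gv_morphism_right : is_coalgebra_morphism (fun t : H ⊗ H^cop =>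
    tfold (fun (h : H) (m : H^cop) =>
      sw2 (of_cop m) (fun m1 m2 => times (h ⊗ m2) * antipodeV m1)) t)
}.

(* target_Tr and target_Tl: T is the inverse of id for the convolution        *)
(* product built from the comultiplication of L^cop and times.                *)
Record is_cocycle_target (H : bijHopfAlgType k) (L : coalgType k)
    (times : L ⊗ L -> L) (one : L) (T : L -> L) (act : L ⊗ H -> L) : Prop := {
  target_times_linear : linear times;
  target_T_linear : linear T;
  target_times_monoid : is_unital_associative times one;
  target_Tr : forall l,
    sw2 l (fun l1 l2 => times (l2 ⊗ T l1)) = counit l *: one;
  target_Tl : forall l,
    sw2 l (fun l1 l2 => times (T l2 ⊗ l1)) = counit l *: one;
  target_module_coalgebra : is_right_module_coalgebra act;
  target_compat : forall (m l : L) (h : H),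
    act (times (m ⊗ l) ⊗ h) =
    sw2 h (fun h1 h2 => times (act (m ⊗ h2) ⊗ act (l ⊗ h1)))
}.

Record is_bijective_cocycle (H : bijHopfAlgType k) (L : coalgType k)
    (times : L ⊗ L -> L) (one : L) (T : L -> L) (act : L ⊗ H -> L)
    (pi : H -> L) : Prop := {
  cocycle_target : is_cocycle_target times one T act;
  cocycle_isomorphism : is_coalgebra_isomorphism pi;
  cocycle_module_coalgebra : is_right_module_coalgebra (fun t : L ⊗ H =>
    tfold (fun l h => sw3 h (fun h1 h2 h3 =>
      times (times (T (pi h3) ⊗ act (l ⊗ h2)) ⊗ pi h1))) t);
  cocycle_mul : forall h m : H,
    pi (h * m) = sw2 m (fun m1 m2 => times (act (pi h ⊗ m2) ⊗ pi m1))
}.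

End SkewBraceAndCocycle.

(* Main.v *)
Require Import Defs.
From HB Require Import structures.
From mathcomp Require Import all_boot all_order all_algebra.

Set Implicit Arguments.
Unset Strict Implicit.
Unset Printing Implicit Defensive.

Import GRing.Theory.
Local Open Scope ring_scope.

(** Write x ⋄ y for the second product, S for the antipode and S' for its
    inverse.  Two maps H ⊗ H -> H govern the proof:
      x ↩ h = x h_2 ⋄ T(h_1)   (actTr)   and   x ▷ h = T(h_2) ⋄ x h_1   (actTl).
    Apply the compatibility (m ⋄ l) h = m h_3 ⋄ T(h_2) ⋄ l h_1 with l = S(h_1),
    or with m = S'(h_2), and cancel against the neighbouring tensor factor:
      (x ⋄ S(h_1)) h_2 = x ↩ h   and   (S'(h_2) ⋄ x) h_1 = x ▷ h
    (actTr_antipode and actTl_antipodeV).  For x = 1 these say that T is the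
    convolution inverse of the identity.  They also say that, up to the
    anticoalgebra isomorphisms S and S' in the second variable, ↩ and ▷ are the
    two maps that a skew brace requires to be coalgebra morphisms
    (gv_left_morphism and gv_right_morphism).

    The module axioms of ↩ and ▷ are consequences of the compatibility alone.
    First, ↩ distributes over ⋄ with reversed Sweedler indices (actTr_times).
    Hence (g, h) |-> T(h_2) ⋄ (T(g) ↩ h_1) is a convolution inverse of the
    multiplication of H, as (g, h) |-> T(g h) is, and uniqueness of inverses
    gives T(g h) = T(h_2) ⋄ (T(g) ↩ h_1) (T_mul).  Substituting this in
    x ↩ g h and x ▷ g h gives the two associativity laws.  This settles the
    direction from skew braces to cocycles, because the map in condition (i) of
    a cocycle is ▷ (sw3_actTl) and condition (ii) is actTr_mul_times with a
    factor 1.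

    Conversely, transport the product, the map T and the action from L to H
    along pi.  The cocycle identity h m = (h ↩ m_2) ⋄ m_1 forces the transported
    action to be x h_2 ⋄ T(h_1) (actTr_transported), and then the distributivity
    of the action over the product turns into the compatibility
    (transported_compat).  The first part of the argument now applies, and the
    two coalgebra conditions on L become the two of a skew brace. *)

(** * Linearity and Sweedler calculus *)

Section LinearClosure.
Variables (k : fieldType) (X W : lmodType k) (A : algType k) (C : coalgType k).

Lemma linear_mull (g : X -> A) (y : A) : linear g -> linear (fun x => g x * y).
Proof. by move=> lg a u v; rewrite lg mulrDl scalerAl. Qed.

Lemma linear_mulr (g : X -> A) (y : A) : linear g -> linear (fun x => y * g x).
Proof. by move=> lg a u v; rewrite lg mulrDr scalerAr. Qed.

Lemma linear_sw2_param (c : C) (F : X -> C -> C -> W) :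
  (forall a b, linear (fun x => F x a b)) -> linear (fun x => sw2 c (F x)).
Proof. exact: linear_tfold_param. Qed.

Lemma linear_sw2 (F : C -> C -> W) (g : X -> C) :
  (forall b, linear (F^~ b)) -> (forall a, linear (F a)) -> linear g ->
  linear (fun x => sw2 (g x) F).
Proof.
move=> Fl Fr lg; apply: linear_tfold_comp; first by split=> ?; [apply: Fl|apply: Fr].
by move=> a u v; rewrite lg comul_linear.
Qed.

End LinearClosure.

(** Peels an expression in one variable operation by operation.  Every map
    assumed linear in the context serves as a further closure rule, so the
    identity must not be among them: it could be peeled off forever. *)
Ltac lin :=
  intros;
  repeat first
    [ assumption
    | exact: linear_idfun
    | exact: comul_linear
    | exact: antipode_linear
    | (match goal with l : linear ?g |- _ => exact: l end)
    | (match goal with l : linear ?g |- _ => apply: (linear_comp_fun l) end)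
    | (apply: (linear_comp_fun antipode_linear))
    | (apply: linear_mull)
    | (apply: linear_mulr)
    | (apply: linear_tensl)
    | (apply: linear_tensr)
    | (apply: linear_scalel; exact: counit_linear)
    | (apply: linear_scaler)
    | (apply: linear_sw2_param => ? ?)
    | (apply: linear_sw2 => [? | ? | ] /=) ].

Section Sweedler.
Variables (k : fieldType) (C : coalgType k) (A W : lmodType k).

Lemma eq_sw2 (V : nmodType) (c : C) (F G : C -> C -> V) :
  (forall a b, F a b = G a b) -> sw2 c F = sw2 c G.
Proof. exact: eq_tfold. Qed.

Lemma sw2_linear_map (g : A -> W) (c : C) (F : C -> C -> A) :
  linear g -> g (sw2 c F) = sw2 c (fun a b => g (F a b)).
Proof. exact: linear_tfold. Qed.

Lemma exchange_sw2 (D : coalgType k) (c : C) (d : D) (F : C -> C -> D -> D -> W) :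
  sw2 c (fun a b => sw2 d (F a b)) =
  sw2 d (fun x y => sw2 c (fun a b => F a b x y)).
Proof. exact: exchange_tfold. Qed.

Lemma sw2_counitl (F : C -> W) c :
  linear F -> sw2 c (fun a b => counit a *: F b) = F c.
Proof.
move=> lF; rewrite -[in RHS](counitl c) linear_tfold //.
by apply: eq_sw2 => a b; rewrite (scalable_linear lF).
Qed.

Lemma sw2_counitr (F : C -> W) c :
  linear F -> sw2 c (fun a b => counit b *: F a) = F c.
Proof.
move=> lF; rewrite -[in RHS](counitr c) linear_tfold //.
by apply: eq_sw2 => a b; rewrite (scalable_linear lF).
Qed.

Lemma sw2_coassoc (F : C -> C -> C -> W) (c : C) :
  (forall y z, linear (fun x => F x y z)) ->
  (forall x z, linear (fun y => F x y z)) ->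
  (forall x y, linear (F x y)) ->
  sw2 c (fun a b => sw2 a (fun a1 a2 => F a1 a2 b)) =
  sw2 c (fun a b => sw2 b (fun b1 b2 => F a b1 b2)).
Proof. exact: sw3_coassoc. Qed.

(** The step by which every later computation cancels two adjacent Sweedler
    factors: reassociate c_1 ⊗ c_2 ⊗ c_3 so that they come from one element,
    replace their u-product by the counit, and absorb the counit. *)
Lemma sw2_cancell (u : C -> C -> A) (e : A) (F : A -> C -> W) (c : C) :
  (forall c, sw2 c u = counit c *: e) ->
  (forall b, linear (u^~ b)) -> (forall a, linear (u a)) ->
  (forall x, linear (F^~ x)) -> (forall a, linear (F a)) ->
  sw2 c (fun a b => sw2 b (fun b1 b2 => F (u a b1) b2)) = F e c.
Proof.
move=> sw2u ul ur Fl Fr; rewrite -(@sw2_coassoc (fun x y z => F (u x y) z)) //.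
- rewrite -[RHS](@sw2_counitl (F e)) //; apply: eq_sw2 => a b.
  by rewrite -(sw2_linear_map _ _ (Fl b)) sw2u (scalable_linear (Fl b)).
- by move=> y z; apply: (linear_comp_fun (Fl z) (ul y)).
- by move=> x z; apply: (linear_comp_fun (Fl z) (ur x)).
Qed.

Lemma sw2_cancelr (u : C -> C -> A) (e : A) (F : C -> A -> W) (c : C) :
  (forall c, sw2 c u = counit c *: e) ->
  (forall b, linear (u^~ b)) -> (forall a, linear (u a)) ->
  (forall x, linear (F^~ x)) -> (forall a, linear (F a)) ->
  sw2 c (fun a b => sw2 a (fun a1 a2 => F a1 (u a2 b))) = F c e.
Proof.
move=> sw2u ul ur Fl Fr; rewrite (@sw2_coassoc (fun x y z => F x (u y z))) //.
- rewrite -[RHS](@sw2_counitr (F^~ e)) //; apply: eq_sw2 => a b.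
  by rewrite -(sw2_linear_map _ _ (Fr a)) sw2u (scalable_linear (Fr a)).
- by move=> y z; apply: (linear_comp_fun (Fr y) (ul z)).
- by move=> x z; apply: (linear_comp_fun (Fr x) (ur z)).
Qed.

End Sweedler.

(** In the convolution monoid Hom(D, A) a left inverse g and a right inverse g'
    of f agree, since g = g * (f * g') = (g * f) * g' = g'.  The product mu is
    an arbitrary function because it is needed for ⋄ with its arguments
    exchanged and for the product of H ⊗ H, neither of which is a declared ring
    structure. *)
Lemma convolution_inverse_unique (k : fieldType) (D : coalgType k)
    (A : lmodType k) (mu : A -> A -> A) (e : A) (f g g' : D -> A) :
  (forall y, linear (mu^~ y)) -> (forall x, linear (mu x)) ->
  associative mu -> left_id e mu -> right_id e mu ->
  linear f -> linear g -> linear g' ->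
  (forall d, sw2 d (fun a b => mu (g a) (f b)) = counit d *: e) ->
  (forall d, sw2 d (fun a b => mu (f a) (g' b)) = counit d *: e) ->
  g =1 g'.
Proof.
move=> mul mur muA mu1l mu1r lf lg lg' gf fg' d.
have lmf x : linear (fun y => mu x (f y)) by apply: linear_comp_fun.
have lmg' x : linear (fun y => mu x (g' y)) by apply: linear_comp_fun.
have lgm y : linear (fun x => mu (g x) y) by apply: (linear_comp_fun (mul y)).
have lfm y : linear (fun x => mu (f x) y) by apply: (linear_comp_fun (mul y)).
rewrite -[LHS]mu1r.
rewrite -(sw2_cancelr (F := fun x y => mu (g x) y) _ fg') //.
rewrite sw2_coassoc //; last 1 first.
- by move=> x z; apply: (linear_comp_fun (mur _)).
- under eq_sw2 => a b do under eq_sw2 => b1 b2 do rewrite muA.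
  rewrite (sw2_cancell (F := fun x y => mu x (g' y)) _ gf) //.
- by move=> x y; apply: (linear_comp_fun (mur _)).
Qed.

Lemma sw2_tens (k : fieldType) (C D : coalgType k) (W : lmodType k)
    (F : C ⊗ D -> C ⊗ D -> W) (c : C) (d : D) :
  (forall b, linear (F^~ b)) -> (forall a, linear (F a)) ->
  sw2 (c ⊗ d) F =
  sw2 c (fun c1 c2 => sw2 d (fun d1 d2 => F (c1 ⊗ d1) (c2 ⊗ d2))).
Proof.
move=> Fl Fr; have bF : bilinear_for *:%R *:%R F by split.
rewrite {1}/sw2 [comul (c ⊗ d)]tensor_comul_tens.
rewrite sw2_linear_map; last exact: tfold_linear.
apply: eq_sw2 => c1 c2; rewrite sw2_linear_map; last exact: tfold_linear.
by apply: eq_sw2 => d1 d2; rewrite tfold_tens.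
Qed.

(** * Coalgebra morphisms *)

Section CoalgebraMorphism.
Variable k : fieldType.

Lemma sw2_morphism (C D : coalgType k) (W : lmodType k) (f : C -> D) (c : C)
    (F : D -> D -> W) :
  is_coalgebra_morphism f ->
  (forall b, linear (F^~ b)) -> (forall a, linear (F a)) ->
  sw2 (f c) F = sw2 c (fun a b => F (f a) (f b)).
Proof.
case=> lf fD _ Fl Fr; have bF : bilinear_for *:%R *:%R F by split.
rewrite {1}/sw2 fD /tmap linear_tfold; last exact: tfold_linear.
by apply: eq_sw2 => a b; rewrite tfold_tens.
Qed.

Lemma eq_coalgebra_morphism (C D : coalgType k) (f g : C -> D) :
  f =1 g -> is_coalgebra_morphism f -> is_coalgebra_morphism g.
Proof.
move=> fg [lf fD fe]; split=> [a x y|c|c]; last by rewrite -fg.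
  by rewrite -!fg lf.
by rewrite -fg fD; apply: eq_tfold => a b; rewrite !fg.
Qed.

Lemma coalgebra_morphism_comp (C D E : coalgType k) (g : D -> E) (f : C -> D) :
  is_coalgebra_morphism g -> is_coalgebra_morphism f ->
  is_coalgebra_morphism (fun x => g (f x)).
Proof.
move=> [lg gD ge] [lf fD fe]; split=> [|c|c].
- exact: linear_comp_fun.
- rewrite gD fD -[tmap f f _]/(tfold (fun a b => f a ⊗ f b) (comul c)).
  rewrite linear_tfold; last exact: tmap_linear.
  by apply: eq_tfold => a b; rewrite tmap_tens.
- by rewrite ge fe.
Qed.

Lemma coalgebra_morphism_tmap (C D C' D' : coalgType k) (f : C -> C') (g : D -> D') :
  is_coalgebra_morphism f -> is_coalgebra_morphism g ->
  is_coalgebra_morphism (tmap f g).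
Proof.
move=> fM gM; have [lf fD fe] := fM; have [lg gD ge] := gM.
have lfg := tmap_linear lf lg.
split=> //; last first.
  apply: (@eq_linear_tens _ _ _ k^o (fun t => counit (tmap f g t)) counit).
  - by move=> a x y; rewrite lfg counit_linear.
  - by move=> a x y; rewrite counit_linear.
  - move=> c d; rewrite tmap_tens //.
    by rewrite [LHS]tensor_counit_tens [RHS]tensor_counit_tens fe ge.
apply: eq_linear_tens.
- by apply: linear_comp_fun => //; exact: tensor_comul_linear.
- apply: linear_comp_fun; [exact: tmap_linear | exact: tensor_comul_linear].
- move=> c d; rewrite tmap_tens //.
  rewrite [LHS]tensor_comul_tens [X in _ = tmap _ _ X]tensor_comul_tens.
  rewrite sw2_linear_map; last exact: tmap_linear.
  rewrite sw2_morphism //; try by lin.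
  apply: eq_sw2 => c1 c2; rewrite sw2_morphism //; try by lin.
  rewrite sw2_linear_map; last exact: tmap_linear.
  by apply: eq_sw2 => d1 d2; rewrite !tmap_tens.
Qed.

Lemma coalgebra_morphism_id (C : coalgType k) : is_coalgebra_morphism (@id C).
Proof. by split=> // c; rewrite /tmap tfold_id. Qed.

End CoalgebraMorphism.

Section AntiMorphism.
Variables (k : fieldType) (C D : coalgType k).

Definition is_anticoalgebra_morphism (f : C -> D) : Prop :=
  [/\ linear f,
      forall c, comul (f c) = sw2 c (fun a b => f b ⊗ f a)
    & forall c, counit (f c) = counit c].

Variable f : C -> D.
Hypothesis fM : is_anticoalgebra_morphism f.

Lemma sw2_anticoalgebra_morphism (W : lmodType k) (F : D -> D -> W) c :
  (forall b, linear (F^~ b)) -> (forall a, linear (F a)) ->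
  sw2 (f c) F = sw2 c (fun a b => F (f b) (f a)).
Proof.
move=> Fl Fr; have bF : bilinear_for *:%R *:%R F by split.
have [_ fD _] := fM.
rewrite {1}/sw2 fD linear_tfold; last exact: tfold_linear.
by apply: eq_tfold => a b; rewrite tfold_tens.
Qed.

(** Both placements of the co-opposite are needed: tensored with the identity of
    H, this one maps H ⊗ H to H ⊗ H^cop and the next one maps H ⊗ H^cop to
    H ⊗ H. *)
Lemma anticoalgebra_morphism_to_cop :
  is_coalgebra_morphism (f : C -> D^cop).
Proof.
have [lf fD fe] := fM; split=> // c.
rewrite -[LHS]/(tswap (comul (f c))) fD.
rewrite sw2_linear_map; last exact: tswap_linear.
by apply: eq_tfold => a b; rewrite tswap_tens.
Qed.

Lemma anticoalgebra_morphism_of_cop :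
  is_coalgebra_morphism (f : C^cop -> D).
Proof.
have [lf fD fe] := fM; split=> // c.
rewrite -[comul c]/(tfold (fun a b : C => (b : C^cop) ⊗ (a : C^cop)) _).
rewrite linear_tfold; last exact: tmap_linear.
by rewrite fD; apply: eq_tfold => a b; rewrite tmap_tens.
Qed.

End AntiMorphism.

(** * The antipode reverses the comultiplication *)

Lemma sw2_mul (k : fieldType) (H : hopfAlgType k) (W : lmodType k)
    (F : H -> H -> W) (g h : H) :
  (forall b, linear (F^~ b)) -> (forall a, linear (F a)) ->
  sw2 (g * h) F =
  sw2 g (fun g1 g2 => sw2 h (fun h1 h2 => F (g1 * h1) (g2 * h2))).
Proof.
move=> Fl Fr; have bF : bilinear_for *:%R *:%R F by split.
have lF := tfold_linear bF.
rewrite {1}/sw2 comulM sw2_linear_map //; apply: eq_sw2 => a b.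
by rewrite sw2_linear_map //; apply: eq_sw2 => c d; rewrite tfold_tens.
Qed.

Section Antipode.
Variables (k : fieldType) (H : hopfAlgType k).
Implicit Types h : H.

(** The product of the algebra H ⊗ H. *)
Definition tmul (s t : H ⊗ H) : H ⊗ H :=
  tfold (fun a b => tfold (fun c d => (a * c) ⊗ (b * d)) t) s.

Lemma tmul_tensl a b t :
  tmul (a ⊗ b) t = tfold (fun c d => (a * c) ⊗ (b * d)) t.
Proof.
rewrite /tmul tfold_tens //; split=> ?; apply: linear_tfold_param => ? ?; lin.
Qed.

Lemma tmul_tens a b c d : tmul (a ⊗ b) (c ⊗ d) = (a * c) ⊗ (b * d).
Proof. by rewrite tmul_tensl tfold_tens //; split=> ?; lin. Qed.

Lemma tmul_linearl t : linear (tmul^~ t).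
Proof.
by apply: tfold_linear; split=> ?; apply: linear_tfold_param => ? ?; lin.
Qed.

Lemma tmul_linearr s : linear (tmul s).
Proof.
apply: linear_tfold_param => a b; apply: tfold_linear; split=> ?; lin.
Qed.

Lemma tmulA : associative tmul.
Proof.
have ll := tmul_linearl; have lr := tmul_linearr => s t r; move: s.
apply: eq_linear_tens => [||a b].
- exact: ll.
- exact: (linear_comp_fun (ll r) (ll t)).
move: t; apply: eq_linear_tens => [||c d].
- exact: (linear_comp_fun (lr _) (ll r)).
- exact: (linear_comp_fun (ll r) (lr _)).
move: r; apply: eq_linear_tens => [||x y].
- exact: (linear_comp_fun (lr _) (lr _)).
- exact: lr.
by rewrite !tmul_tens !mulrA.
Qed.

Lemma tmul1l : left_id (1 ⊗ 1) tmul.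
Proof.
apply: eq_linear_tens => [||a b]; [exact: tmul_linearr|by []|].
by rewrite tmul_tens !mul1r.
Qed.

Lemma tmul1r : right_id (1 ⊗ 1) tmul.
Proof.
apply: eq_linear_tens => [||a b]; [exact: tmul_linearl|by []|].
by rewrite tmul_tens !mulr1.
Qed.

Lemma counit_antipode h : counit (antipode h) = counit h.
Proof.
have lc : linear (counit : H -> k^o) by exact: counit_linear.
have := congr1 counit (antipoder h).
rewrite (scalable_linear lc) counit1 [RHS]mulr1 => <-.
rewrite (sw2_linear_map (W := k^o) _ _ lc).
under eq_sw2 => a b do rewrite counitM.
symmetry; apply: (sw2_counitl (W := k^o) (F := fun b => counit (antipode b))).
by move=> a x y; rewrite antipode_linear counit_linear.
Qed.

(** Both sides are convolution inverses of the comultiplication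
    H -> H ⊗ H. *)
Lemma comul_antipode h :
  comul (antipode h) = sw2 h (fun a b => antipode b ⊗ antipode a).
Proof.
have lS : linear (antipode : H -> H) := antipode_linear.
have lc : linear (comul : H -> _) := comul_linear.
move: h; apply: (convolution_inverse_unique (mu := tmul) (e := 1 ⊗ 1)
    (f := comul)) => [y|x|||||||h|h].
- exact: tmul_linearl.
- exact: tmul_linearr.
- exact: tmulA.
- exact: tmul1l.
- exact: tmul1r.
- by [].
- exact: linear_comp_fun.
- by lin.
- have tmul_comul a b : tmul (comul a) (comul b) = comul (a * b).
    by rewrite comulM.
  under eq_sw2 => a b do rewrite tmul_comul.
  rewrite -(sw2_linear_map _ _ lc) antipodel -comul1.
  exact: (scalable_linear lc).
under eq_sw2 => a b do rewrite (sw2_linear_map _ _ (tmul_linearr _)).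
transitivity (sw2 h (fun a b => sw2 a (fun a1 a2 => sw2 b (fun b1 b2 =>
   (a1 * antipode b2) ⊗ (a2 * antipode b1))))).
  apply: eq_sw2 => a b; rewrite exchange_sw2; apply: eq_sw2 => b1 b2.
  by rewrite -{1}[comul a]tfold_id (linear_tfold _ _ (tmul_linearl _));
    apply: eq_tfold => a1 a2; rewrite tmul_tens.
rewrite sw2_coassoc; try by lin.
(* In h_1 S(h_4) ⊗ h_2 S(h_3) the inner pair h_2, h_3 cancels first.          *)
transitivity (sw2 h (fun a b => (a * antipode b) ⊗ (1 : H))).
  apply: eq_sw2 => a r.
  rewrite -(@sw2_coassoc _ _ _ (fun y z t => (a * antipode t) ⊗ (y * antipode z)));
    try by lin.
  rewrite -(sw2_counitl (F := fun b => (a * antipode b) ⊗ (1 : H))); last by lin.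
  apply: eq_sw2 => c d; rewrite -tensZr -antipoder sw2_linear_map //.
  exact: (bilinear_tens _ _).2.
rewrite -(sw2_linear_map (g := fun x : H => x ⊗ (1 : H))); last by lin.
by rewrite antipoder tensZl.
Qed.

Lemma antipode_anticoalgebra : is_anticoalgebra_morphism (antipode : H -> H).
Proof.
split=> [|h|h]; [exact: antipode_linear| |exact: counit_antipode].
exact: comul_antipode.
Qed.

End Antipode.

Section BijectiveAntipode.
Variables (k : fieldType) (H : bijHopfAlgType k).
Implicit Types h : H.

Lemma linear_antipodeV : linear (antipodeV : H -> H).
Proof.
move=> a x y; apply: (can_inj antipodeK).
by rewrite antipode_linear !antipodeVK.
Qed.

Lemma comul_antipodeV h :
  comul (antipodeV h) = sw2 h (fun a b => antipodeV b ⊗ antipodeV a).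
Proof.
have lV := linear_antipodeV.
rewrite -{2}[h]antipodeVK /sw2 comul_antipode.
rewrite /sw2 linear_tfold; last by apply: tfold_linear; split=> ?; lin.
rewrite -[LHS]tfold_id; apply: eq_tfold => a b.
by rewrite tfold_tens ?antipodeK //; split=> ?; lin.
Qed.

Lemma antipodeV_anticoalgebra : is_anticoalgebra_morphism (antipodeV : H -> H).
Proof.
split=> [|h|h]; [exact: linear_antipodeV|exact: comul_antipodeV|].
by rewrite -{2}[h]antipodeVK counit_antipode.
Qed.

(** Substituting h = S(x) and using that S is an anticoalgebra map reduces this
    to the antipode axiom for x; the antimultiplicativity of S is avoided. *)
Lemma antipodeVl h : sw2 h (fun a b => antipodeV b * a) = (counit h)%:A.
Proof.
have lV := linear_antipodeV.
rewrite -{1}[h]antipodeVK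
  (sw2_anticoalgebra_morphism (antipode_anticoalgebra H)); try by lin.
under eq_sw2 => a b do rewrite antipodeK.
by rewrite antipoder -(counit_antipode (antipodeV h)) antipodeVK.
Qed.

End BijectiveAntipode.

(** * The two actions attached to a compatible pair of products *)

Section Actions.
Variables (k : fieldType) (H : bijHopfAlgType k).
Variables (times : H ⊗ H -> H) (T : H -> H).
Local Notation "x ⋄ y" := (times (x ⊗ y)) (at level 44, left associativity).

Hypothesis lt : linear times.
Hypothesis lT : linear T.
Hypothesis timesP : is_unital_associative times 1.
Hypothesis compat : forall h m l : H, (m ⋄ l) * h =
  sw3 h (fun h1 h2 h3 => m * h3 ⋄ T h2 ⋄ l * h1).

Let timesA x y z : x ⋄ y ⋄ z = x ⋄ (y ⋄ z). Proof. by case: timesP. Qed.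
Let times1l x : 1 ⋄ x = x. Proof. by case: timesP. Qed.
Let times1r x : x ⋄ 1 = x. Proof. by case: timesP. Qed.
Let lS : linear (antipode : H -> H) := antipode_linear.
Let lV : linear (antipodeV : H -> H) := @linear_antipodeV _ H.

(** Both are right actions of H on itself; the suffix tells on which side of
    the product ⋄ the factor T stands. *)
Definition actTr (x h : H) : H := sw2 h (fun a b => x * b ⋄ T a).
Definition actTl (x h : H) : H := sw2 h (fun a b => T b ⋄ x * a).

Lemma actTr_linearl h : linear (actTr^~ h).
Proof. by rewrite /actTr; lin. Qed.

Lemma actTr_linearr x : linear (actTr x).
Proof. by rewrite /actTr; lin. Qed.

Lemma actTl_linearl h : linear (actTl^~ h).
Proof. by rewrite /actTl; lin. Qed.

Lemma actTl_linearr x : linear (actTl x).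
Proof. by rewrite /actTl; lin. Qed.

Lemma times_mul m l h : (m ⋄ l) * h =
  sw2 h (fun a b => sw2 b (fun b1 b2 => m * b2 ⋄ T b1 ⋄ l * a)).
Proof. by rewrite compat sw3_coassoc //; lin. Qed.

(** Compatibility with l = S(h_1): the factor S(h_1) h_2 of the right-hand side
    cancels. *)
Lemma actTr_antipode x h : sw2 h (fun a b => (x ⋄ antipode a) * b) = actTr x h.
Proof.
under eq_sw2 => a b do rewrite times_mul.
have lF y : linear (fun c => sw2 c (fun b c => x * c ⋄ T b ⋄ y)) by lin.
rewrite (sw2_cancell (u := fun a b => antipode a * b) (e := 1)
  (F := fun y c => sw2 c (fun b c => x * c ⋄ T b ⋄ y))); try by lin.
- by apply: eq_sw2 => a b; rewrite times1r.
- exact: antipodel.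
Qed.

(** Compatibility with m = S'(h_2): the factor S'(h_4) h_3 of the right-hand
    side cancels. *)
Lemma actTl_antipodeV x h :
  sw2 h (fun a b => (antipodeV b ⋄ x) * a) = actTl x h.
Proof.
under eq_sw2 => a b do rewrite compat.
rewrite (sw2_cancelr (u := fun a b => antipodeV b * a) (e := 1)
  (F := fun c y => sw2 c (fun a b => y ⋄ T b ⋄ x * a))); try by lin.
- by apply: eq_sw2 => a b; rewrite times1l.
- exact: antipodeVl.
Qed.

(** The case x = 1 of the preceding identities, where the left-hand sides
    become antipode axioms. *)
Lemma T_right_inverse h : sw2 h (fun a b => b ⋄ T a) = counit h *: 1.
Proof.
have := actTr_antipode 1 h; rewrite /actTr.
under eq_sw2 => a b do rewrite times1l; rewrite antipodel => ->.
by apply: eq_sw2 => a b; rewrite mul1r.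
Qed.

Lemma T_left_inverse h : sw2 h (fun a b => T b ⋄ a) = counit h *: 1.
Proof.
have := actTl_antipodeV 1 h; rewrite /actTl.
under eq_sw2 => a b do rewrite times1r; rewrite antipodeVl => ->.
by apply: eq_sw2 => a b; rewrite mul1r.
Qed.

Lemma T1 : T 1 = 1.
Proof.
have := T_right_inverse 1.
rewrite /sw2 comul1 tfold_tens; last by split=> ?; lin.
by rewrite times1l counit1 scale1r.
Qed.

Lemma actTr1 x : actTr x 1 = x.
Proof.
rewrite /actTr /sw2 comul1 tfold_tens; last by split=> ?; lin.
by rewrite T1 times1r mulr1.
Qed.

Lemma actTl1 x : actTl x 1 = x.
Proof.
rewrite /actTl /sw2 comul1 tfold_tens; last by split=> ?; lin.
by rewrite T1 times1l mulr1.
Qed.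

(** The compatibility read as a cocycle identity: its two factors m h_3 and
    T(h_2) form an action. *)
Lemma actTr_mul_times x y h :
  sw2 h (fun a b => actTr x b ⋄ y * a) = (x ⋄ y) * h.
Proof.
have lx := actTr_linearr x.
rewrite times_mul; apply: eq_sw2 => a b; rewrite [in LHS]/actTr.
by rewrite (sw2_linear_map (g := fun z => z ⋄ y * a)) //; lin.
Qed.

Lemma actTr_times x y h :
  actTr (x ⋄ y) h = sw2 h (fun a b => actTr x b ⋄ actTr y a).
Proof.
have lx := actTr_linearr x.
transitivity (sw2 h (fun a b => sw2 a (fun a1 a2 => actTr x b ⋄ (y * a2 ⋄ T a1)))).
  rewrite sw2_coassoc; try by lin.
  apply: eq_sw2 => a b; rewrite -actTr_mul_times.
  rewrite (sw2_linear_map (g := fun z => z ⋄ T a)); last by lin.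
  by apply: eq_sw2 => b1 b2; rewrite timesA.
apply: eq_sw2 => a b.
by rewrite -(sw2_linear_map (g := fun z => actTr x b ⋄ z)) //; lin.
Qed.

Lemma actTr_one h : actTr 1 h = counit h *: 1.
Proof.
by rewrite -T_right_inverse; apply: eq_sw2 => a b; rewrite mul1r.
Qed.

(** Both sides, seen as maps on the coalgebra H ⊗ H, are inverses of the
    multiplication for the convolution product built from ⋄ with its arguments
    exchanged. *)
Lemma T_mul g h : T (g * h) = sw2 h (fun a b => T b ⋄ actTr (T g) a).
Proof.
have al := actTr_linearl; have ar := actTr_linearr.
have bm : bilinear_for *:%R *:%R (fun x y : H => x * y) by split=> ?; lin.
have lm := tfold_linear bm.
pose X (g h : H) := sw2 h (fun a b => T b ⋄ actTr (T g) a).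
have bX : bilinear_for *:%R *:%R X by split=> ?; rewrite /X; lin.
have lX := tfold_linear bX.
set m := tfold _ in lm; set Xt := tfold X in lX.
have mE x y : m (x ⊗ y) = x * y by exact: tfold_tens.
have XE x y : Xt (x ⊗ y) = X x y by exact: tfold_tens.
have leps (x : H) : linear (fun t : H ⊗ H => counit t *: x).
  by move=> a u v; rewrite counit_linear scalerDl scalerA.
have key : Xt =1 (fun t => T (m t)).
  apply: (convolution_inverse_unique (mu := fun x y => y ⋄ x) (e := 1)
    (f := m)); try by lin.
  - apply: eq_linear_tens; try by lin.
    move=> {}g {}h; rewrite sw2_tens; try by lin.
    (* ε(g) ε(h) 1 = ε(g) (1 ↩ h) = (g_2 ⋄ T(g_1)) ↩ h, which expands to       *)
    (* g_2 h_3 ⋄ T(h_2) ⋄ (T(g_1) ↩ h_1)                                     *)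
    rewrite [counit _]tensor_counit_tens -scalerA -actTr_one.
    rewrite -(scalable_linear (al h)) -T_right_inverse.
    rewrite (sw2_linear_map _ _ (al h)); apply: eq_sw2 => g1 g2.
    rewrite actTr_times.
    transitivity (sw2 h (fun a b => sw2 b (fun b1 b2 =>
      g2 * b2 ⋄ T b1 ⋄ actTr (T g1) a))); last first.
      apply: eq_sw2 => a b.
      by rewrite -(sw2_linear_map (g := fun z => z ⋄ actTr (T g1) a)) //; lin.
    rewrite -(@sw2_coassoc _ _ _ (fun a b1 b2 => g2 * b2 ⋄ T b1 ⋄ actTr (T g1) a));
      try by lin.
    apply: eq_sw2 => h1 h2; rewrite !mE XE /X.
    rewrite (sw2_linear_map (g := fun z => g2 * h2 ⋄ z)); last by lin.
    by apply: eq_sw2 => a b; rewrite timesA.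
  - apply: eq_linear_tens; try by lin.
    move=> {}g {}h; rewrite sw2_tens; try by lin.
    rewrite [counit _]tensor_counit_tens -counitM -T_left_inverse.
    rewrite sw2_mul; try by lin.
    by apply: eq_sw2 => g1 g2; apply: eq_sw2 => h1 h2; rewrite !mE.
by rewrite -mE -key XE.
Qed.

Lemma actTr_mul x g h : actTr x (g * h) = actTr (actTr x g) h.
Proof.
have al := actTr_linearl; have ar := actTr_linearr.
rewrite {1}/actTr sw2_mul; try by lin.
rewrite [actTr x g]/actTr (sw2_linear_map _ _ (al h)).
apply: eq_sw2 => g1 g2; rewrite actTr_times.
transitivity (sw2 h (fun a b => sw2 a (fun a1 a2 =>
  x * g2 * b ⋄ T a2 ⋄ actTr (T g1) a1))).
  apply: eq_sw2 => a b; rewrite T_mul.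
  rewrite (sw2_linear_map (g := fun z => x * (g2 * b) ⋄ z)); last by lin.
  by apply: eq_sw2 => a1 a2; rewrite timesA mulrA.
rewrite sw2_coassoc; try by lin.
apply: eq_sw2 => a b.
by rewrite -(sw2_linear_map (g := fun z => z ⋄ actTr (T g1) a)) //; lin.
Qed.

Lemma actTl_mul x g h : actTl x (g * h) = actTl (actTl x g) h.
Proof.
have al := actTr_linearl; have ar := actTr_linearr.
have cl := actTl_linearl; have cr := actTl_linearr.
rewrite {1}/actTl sw2_mul; try by lin.
rewrite [actTl x g]/actTl (sw2_linear_map _ _ (cl h)).
apply: eq_sw2 => g1 g2.
transitivity (sw2 h (fun a b => sw2 b (fun b1 b2 =>
  T b2 ⋄ (actTr (T g2) b1 ⋄ x * g1 * a)))).
  apply: eq_sw2 => a b; rewrite T_mul mulrA.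
  rewrite (sw2_linear_map (g := fun z => z ⋄ x * g1 * a)); last by lin.
  by apply: eq_sw2 => b1 b2; rewrite timesA.
rewrite -(@sw2_coassoc _ _ _ (fun a b1 b2 => T b2 ⋄ (actTr (T g2) b1 ⋄ x * g1 * a)));
  try by lin.
apply: eq_sw2 => a b.
rewrite -(sw2_linear_map (g := fun z => T b ⋄ z)); last by lin.
by rewrite actTr_mul_times.
Qed.

(** Identifies the map of condition (i) of a cocycle: the last two factors
    (x ↩ h_2) ⋄ h_1 collapse to x h. *)
Lemma sw3_actTl x h :
  sw3 h (fun a b c => T c ⋄ actTr x b ⋄ a) = actTl x h.
Proof.
have ar := actTr_linearr; rewrite /sw3; apply: eq_sw2 => ab c.
under eq_sw2 => a b do rewrite timesA.
rewrite -(sw2_linear_map (g := fun z => T c ⋄ z)); last by lin.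
rewrite -[x in RHS]times1r -actTr_mul_times.
by congr (_ ⋄ _); apply: eq_sw2 => a b; rewrite mul1r.
Qed.

Definition actTr_map (t : H ⊗ H) : H := tfold actTr t.
Definition actTl_map (t : H ⊗ H) : H := tfold actTl t.

Lemma bilinear_actTr : bilinear_for *:%R *:%R actTr.
Proof. by split=> ? /=; [exact: actTr_linearl | exact: actTr_linearr]. Qed.

Lemma bilinear_actTl : bilinear_for *:%R *:%R actTl.
Proof. by split=> ? /=; [exact: actTl_linearl | exact: actTl_linearr]. Qed.

Lemma actTr_map_tens x h : actTr_map (x ⊗ h) = actTr x h.
Proof. exact: (tfold_tens _ _ bilinear_actTr). Qed.

Lemma actTl_map_tens x h : actTl_map (x ⊗ h) = actTl x h.
Proof. exact: (tfold_tens _ _ bilinear_actTl). Qed.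

Lemma actTr_map_module : is_right_module actTr_map.
Proof.
split=> [|x|x g h]; first exact: (tfold_linear bilinear_actTr).
- by rewrite actTr_map_tens actTr1.
- by rewrite !actTr_map_tens actTr_mul.
Qed.

Lemma actTl_map_module : is_right_module actTl_map.
Proof.
split=> [|x|x g h]; first exact: (tfold_linear bilinear_actTl).
- by rewrite actTl_map_tens actTl1.
- by rewrite !actTl_map_tens actTl_mul.
Qed.

Definition gv_left (t : H ⊗ H^cop) : H :=
  tfold (fun (h : H) (m : H^cop) =>
    sw2 (of_cop m) (fun m1 m2 => (m1 ⋄ h) * antipode m2)) t.

Definition gv_right (t : H ⊗ H^cop) : H :=
  tfold (fun (h : H) (m : H^cop) =>
    sw2 (of_cop m) (fun m1 m2 => (h ⋄ m2) * antipodeV m1)) t.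

Let bilinear_gv_left : bilinear_for *:%R *:%R (fun (h : H) (m : H) =>
  sw2 m (fun m1 m2 => (m1 ⋄ h) * antipode m2)).
Proof. by split=> ? /=; lin. Qed.

Let bilinear_gv_right : bilinear_for *:%R *:%R (fun (h : H) (m : H) =>
  sw2 m (fun m1 m2 => (h ⋄ m2) * antipodeV m1)).
Proof. by split=> ? /=; lin. Qed.

(** Substituting S(m) for h in actTl_antipodeV turns S'(h_2) and h_1 into m_1
    and S(m_2). *)
Lemma gv_left_actTl (t : H ⊗ H^cop) :
  gv_left t = actTl_map (tmap id (antipode : H^cop -> H) t).
Proof.
have lS' : linear (antipode : H^cop -> H) by exact: lS.
move: t; apply: eq_linear_tens => [||h m].
- exact: (tfold_linear bilinear_gv_left).
- exact: (linear_comp_fun (tfold_linear bilinear_actTl)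
    (tmap_linear (@linear_idfun _ H) lS')).
rewrite tmap_tens // actTl_map_tens -actTl_antipodeV.
rewrite (sw2_anticoalgebra_morphism (antipode_anticoalgebra H)); try by lin.
under [RHS]eq_sw2 => a b do rewrite antipodeK.
exact: (tfold_tens _ _ bilinear_gv_left).
Qed.

(** Substituting S'(m) for h in actTr_antipode turns S(h_1) and h_2 into m_2
    and S'(m_1). *)
Lemma gv_right_actTr (t : H ⊗ H^cop) :
  gv_right t = actTr_map (tmap id (antipodeV : H^cop -> H) t).
Proof.
have lV' : linear (antipodeV : H^cop -> H) by exact: lV.
move: t; apply: eq_linear_tens => [||h m].
- exact: (tfold_linear bilinear_gv_right).
- exact: (linear_comp_fun (tfold_linear bilinear_actTr)
    (tmap_linear (@linear_idfun _ H) lV')).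
rewrite tmap_tens // actTr_map_tens -actTr_antipode.
rewrite (sw2_anticoalgebra_morphism (antipodeV_anticoalgebra H)); try by lin.
under [RHS]eq_sw2 => a b do rewrite antipodeVK.
exact: (tfold_tens _ _ bilinear_gv_right).
Qed.

Lemma tmap_cop_cancel (f g : H -> H) (t : H ⊗ H) :
  linear f -> linear g -> cancel g f ->
  tmap id (f : H^cop -> H) (tmap id (g : H -> H^cop) t) = t.
Proof.
move=> lf lg gK.
have lf' : linear (f : H^cop -> H) by exact: lf.
have lg' : linear (g : H -> H^cop) by exact: lg.
move: t; apply: eq_linear_tens => [|//|a b].
  exact: (linear_comp_fun (tmap_linear (@linear_idfun _ H) lf')
    (tmap_linear (@linear_idfun _ H) lg')).
by rewrite !tmap_tens // gK.
Qed.

Lemma gv_left_morphism :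
  is_coalgebra_morphism gv_left <-> is_coalgebra_morphism actTl_map.
Proof.
have idM := coalgebra_morphism_id H.
split=> M.
- have SM := anticoalgebra_morphism_to_cop (antipodeV_anticoalgebra H).
  apply: (eq_coalgebra_morphism _
    (coalgebra_morphism_comp M (coalgebra_morphism_tmap idM SM))) => t.
  by rewrite gv_left_actTl tmap_cop_cancel //; exact: antipodeVK.
- have SM := anticoalgebra_morphism_of_cop (antipode_anticoalgebra H).
  apply: (eq_coalgebra_morphism _
    (coalgebra_morphism_comp M (coalgebra_morphism_tmap idM SM))) => t.
  by rewrite gv_left_actTl.
Qed.

Lemma gv_right_morphism :
  is_coalgebra_morphism gv_right <-> is_coalgebra_morphism actTr_map.
Proof.
have idM := coalgebra_morphism_id H.
split=> M.
- have SM := anticoalgebra_morphism_to_cop (antipode_anticoalgebra H).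
  apply: (eq_coalgebra_morphism _
    (coalgebra_morphism_comp M (coalgebra_morphism_tmap idM SM))) => t.
  by rewrite gv_right_actTr tmap_cop_cancel //; exact: antipodeK.
- have SM := anticoalgebra_morphism_of_cop (antipodeV_anticoalgebra H).
  apply: (eq_coalgebra_morphism _
    (coalgebra_morphism_comp M (coalgebra_morphism_tmap idM SM))) => t.
  by rewrite gv_right_actTr.
Qed.

End Actions.

(** * From skew braces to cocycles *)

Lemma eq_right_module_coalgebra (k : fieldType) (L : coalgType k)
    (H : hopfAlgType k) (f g : L ⊗ H -> L) :
  f =1 g -> is_right_module_coalgebra f -> is_right_module_coalgebra g.
Proof.
move=> fg [[lf f1 fM] fC]; split; last exact: eq_coalgebra_morphism fC.
split=> [a x y|l|l h m]; by rewrite -!fg ?lf ?f1 ?fM.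
Qed.

Lemma cocycle_of_skew_brace (k : fieldType) (H : bijHopfAlgType k)
    (times : H ⊗ H -> H) (T : H -> H) :
  is_GV_Hopf_skew_brace times T ->
  is_bijective_cocycle times 1 T
    (fun t : H ⊗ H =>
       tfold (fun h l => sw2 l (fun l1 l2 => times (h * l2 ⊗ T l1))) t)
    (@id H).
Proof.
case=> lt lT timesP compat Lmor Rmor.
have timesr x : times (x ⊗ 1) = x by case: timesP.
have actE : forall x h, tfold (fun h l =>
    sw2 l (fun l1 l2 => times (h * l2 ⊗ T l1))) (x ⊗ h) = actTr times T x h.
  exact: actTr_map_tens.
split.
- split=> //.
  + exact: T_right_inverse.
  + exact: T_left_inverse.
  + split; first exact: actTr_map_module.
    exact/gv_right_morphism.
  + move=> m l h; rewrite actE actTr_times //.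
    by apply: eq_sw2 => a b; rewrite !actE.
- by split; [exact: coalgebra_morphism_id | exists id].
- have E t : actTl_map times T t = tfold (fun l h => sw3 h (fun h1 h2 h3 =>
      times (times (T h3 ⊗ actTr times T l h2) ⊗ h1))) t.
    by apply: eq_tfold => x h; rewrite sw3_actTl.
  apply: (@eq_right_module_coalgebra _ _ _ (actTl_map times T)).
    move=> t; rewrite E; apply: eq_tfold => x h; apply: eq_sw2 => ab c.
    by apply: eq_sw2 => a b; rewrite actE.
  split; first exact: actTl_map_module.
  exact/gv_left_morphism.
- move=> h m; rewrite /= -[h in LHS]timesr -(actTr_mul_times lt lT compat).
  by apply: eq_sw2 => a b; rewrite mul1r actE.
Qed.

(** * From cocycles to skew braces *)

Section Transport.
Variables (k : fieldType) (H : bijHopfAlgType k) (L : coalgType k).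
Variables (times' : L ⊗ L -> L) (one : L) (T' : L -> L) (act' : L ⊗ H -> L).
Variables (pi : H -> L) (piV : L -> H).
Hypothesis piP : is_bijective_cocycle times' one T' act' pi.
Hypothesis piK : cancel pi piV.
Hypothesis piVK : cancel piV pi.

Definition transported_times (t : H ⊗ H) : H :=
  tfold (fun h l => piV (times' (pi h ⊗ pi l))) t.
Definition transported_T (h : H) : H := piV (T' (pi h)).
Let actH (x h : H) : H := piV (act' (pi x ⊗ h)).

Local Notation times := transported_times.
Local Notation T := transported_T.
Local Notation "x ⋄ y" := (times (x ⊗ y)) (at level 44, left associativity).

Let targetP : is_cocycle_target times' one T' act'.
Proof. exact: cocycle_target piP. Qed.
Let pi_morphism : is_coalgebra_morphism pi.
Proof. by case: (cocycle_isomorphism piP). Qed.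
Let lpi : linear pi. Proof. by case: pi_morphism. Qed.
Let lt' : linear times'. Proof. exact: target_times_linear targetP. Qed.
Let lT' : linear T'. Proof. exact: target_T_linear targetP. Qed.
Let act'_morphism : is_coalgebra_morphism act'.
Proof. by case: (target_module_coalgebra targetP). Qed.
Let lact' : linear act'. Proof. by case: act'_morphism. Qed.

Let piV_morphism : is_coalgebra_morphism piV.
Proof.
have [_ piD pie] := pi_morphism.
have lpiV : linear piV.
  by move=> a x y; apply: (can_inj piK); rewrite lpi !piVK.
split=> // c; last by rewrite -pie piVK.
rewrite -{2}[c]piVK piD -[LHS]tfold_id /tmap linear_tfold; last first.
  by apply: tfold_linear; split=> ?; lin.
by apply: eq_tfold => a b; rewrite tfold_tens ?piK //; split=> ?; lin.
Qed.
Let lpiV : linear piV. Proof. by case: piV_morphism. Qed.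

Let bilinear_times :
  bilinear_for *:%R *:%R (fun h l : H => piV (times' (pi h ⊗ pi l))).
Proof. by split=> ?; lin. Qed.

Let timesE x y : x ⋄ y = piV (times' (pi x ⊗ pi y)).
Proof. exact: (tfold_tens _ _ bilinear_times). Qed.

Lemma transported_times_linear : linear times.
Proof. exact: (tfold_linear bilinear_times). Qed.

Lemma transported_T_linear : linear T.
Proof. by rewrite /transported_T; lin. Qed.

Let lt := transported_times_linear.
Let lT := transported_T_linear.
Let lactl h : linear (actH^~ h). Proof. by rewrite /actH; lin. Qed.
Let lactr x : linear (actH x). Proof. by rewrite /actH; lin. Qed.

(** The cocycle identity at (1, 1) makes pi(1) idempotent for the product of L,
    and pi(1) is invertible there because it is grouplike. *)
Lemma cocycle_unit : pi 1 = one.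
Proof.
have [tA t1l t1r] := target_times_monoid targetP.
have [[_ act1 _] _] := target_module_coalgebra targetP.
have [_ piD pie] := pi_morphism.
have sw1 (F : L -> L -> L) : bilinear_for *:%R *:%R F ->
    sw2 (pi 1) F = F (pi 1) (pi 1).
  move=> bF; rewrite /sw2 piD comul1 tmap_tens // tfold_tens //.
have idem : times' (pi 1 ⊗ pi 1) = pi 1.
  have := cocycle_mul piP 1 1; rewrite mulr1 /sw2 comul1 tfold_tens.
    by rewrite act1.
  by split=> ?; lin.
have := target_Tr targetP (pi 1); rewrite sw1; last by split=> ?; lin.
rewrite pie counit1 scale1r => inv.
by rewrite -[LHS]t1r -inv -tA idem inv.
Qed.

Lemma transported_times_monoid : is_unital_associative times 1.
Proof.
have [tA t1l t1r] := target_times_monoid targetP.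
split=> *; first by rewrite !timesE !piVK tA.
- by rewrite timesE cocycle_unit t1l piK.
- by rewrite timesE cocycle_unit t1r piK.
Qed.

Let timesA x y z : x ⋄ y ⋄ z = x ⋄ (y ⋄ z).
Proof. by case: transported_times_monoid. Qed.
Let times1r x : x ⋄ 1 = x.
Proof. by case: transported_times_monoid. Qed.

Lemma transported_T_right h : sw2 h (fun a b => b ⋄ T a) = counit h *: 1.
Proof.
have [_ _ pie] := pi_morphism.
have := congr1 piV (target_Tr targetP (pi h)).
rewrite sw2_morphism //; try by lin.
rewrite sw2_linear_map // pie -cocycle_unit (scalable_linear lpiV) piK => <-.
by apply: eq_sw2 => a b; rewrite timesE piVK.
Qed.

Lemma cocycle_mulE g h : g * h = sw2 h (fun a b => actH g b ⋄ a).
Proof.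
rewrite -[LHS]piK (cocycle_mul piP) sw2_linear_map //.
by apply: eq_sw2 => a b; rewrite timesE piVK.
Qed.

Lemma actH_times m l h :
  actH (m ⋄ l) h = sw2 h (fun a b => actH m b ⋄ actH l a).
Proof.
rewrite /actH timesE piVK (target_compat targetP) sw2_linear_map //.
by apply: eq_sw2 => a b; rewrite timesE !piVK.
Qed.

(** By the cocycle identity, x h_2 ⋄ T(h_1) = (x ↩ h_3) ⋄ h_2 ⋄ T(h_1), where
    h_2 ⋄ T(h_1) cancels. *)
Lemma actTr_transported x h : actTr times T x h = actH x h.
Proof.
rewrite /actTr.
transitivity (sw2 h (fun a b => sw2 b (fun b1 b2 => actH x b2 ⋄ (b1 ⋄ T a)))).
  apply: eq_sw2 => a b; rewrite cocycle_mulE.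
  rewrite (sw2_linear_map (g := fun z => z ⋄ T a)); last by lin.
  by apply: eq_sw2 => b1 b2; rewrite timesA.
rewrite (sw2_cancell (u := fun a b => b ⋄ T a) (F := fun y z => actH x z ⋄ y)
  _ transported_T_right) ?times1r //; by lin.
Qed.

(** Both sides equal (m ↩ h_3) ⋄ (l ↩ h_2) ⋄ h_1: the left one by the cocycle
    identity followed by the distributivity of the action, the right one by
    recognising m ↩ h in m h_2 ⋄ T(h_1) and expanding l h. *)
Lemma transported_compat h m l : (m ⋄ l) * h =
  sw3 h (fun h1 h2 h3 => m * h3 ⋄ T h2 ⋄ l * h1).
Proof.
rewrite sw3_coassoc; try by lin.
transitivity (sw2 h (fun a b => sw2 a (fun a1 a2 => actH m b ⋄ (actH l a2 ⋄ a1)))).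
  rewrite sw2_coassoc; try by lin.
  rewrite cocycle_mulE; apply: eq_sw2 => a b; rewrite actH_times.
  rewrite (sw2_linear_map (g := fun z => z ⋄ a)); last by lin.
  by apply: eq_sw2 => b1 b2; rewrite timesA.
apply: eq_sw2 => a b.
rewrite -(sw2_linear_map (g := fun z => actH m b ⋄ z)); last by lin.
rewrite -cocycle_mulE -actTr_transported.
by rewrite (sw2_linear_map (g := fun z => z ⋄ l * a)); last by lin.
Qed.

Let tmap_pi_morphism : is_coalgebra_morphism (tmap pi (@id H)).
Proof. exact: coalgebra_morphism_tmap (coalgebra_morphism_id H). Qed.

Lemma actTr_map_transported_morphism : is_coalgebra_morphism (actTr_map times T).
Proof.
have M := coalgebra_morphism_comp act'_morphism tmap_pi_morphism.
have M' := coalgebra_morphism_comp piV_morphism M.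
apply: (eq_coalgebra_morphism _ M'); apply: eq_linear_tens => [||x h].
- by case: M'.
- exact: (tfold_linear (bilinear_actTr lt lT)).
by rewrite tmap_tens // actTr_map_tens // actTr_transported.
Qed.

Lemma actTl_map_transported_morphism :
  is_coalgebra_morphism (actTl_map times T).
Proof.
have [_ M1] := cocycle_module_coalgebra piP.
have M := coalgebra_morphism_comp M1 tmap_pi_morphism.
have M' := coalgebra_morphism_comp piV_morphism M.
apply: (eq_coalgebra_morphism _ M'); apply: eq_linear_tens => [||x h].
- by case: M'.
- exact: (tfold_linear (bilinear_actTl lt lT)).
rewrite tmap_tens // tfold_tens; last by rewrite /sw3; split=> ?; lin.
rewrite actTl_map_tens // -(sw3_actTl lt lT transported_times_monoid
  transported_compat).
rewrite sw2_linear_map //; apply: eq_sw2 => ab c.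
rewrite sw2_linear_map //; apply: eq_sw2 => a b.
by rewrite actTr_transported !timesE !piVK.
Qed.

Lemma skew_brace_of_cocycle : is_GV_Hopf_skew_brace times T.
Proof.
have tP := transported_times_monoid; have tM := transported_compat.
split=> //.
- exact/(gv_left_morphism lt lT tP tM)/actTl_map_transported_morphism.
- exact/(gv_right_morphism lt lT tP tM)/actTr_map_transported_morphism.
Qed.

End Transport.

Theorem proposition6p30 (k : fieldType) :
  (forall (H : bijHopfAlgType k) (times : H ⊗ H -> H) (T : H -> H),
     is_GV_Hopf_skew_brace times T ->
     is_bijective_cocycle times 1 T
       (fun t : H ⊗ H =>
          tfold (fun h l => sw2 l (fun l1 l2 => times (h * l2 ⊗ T l1))) t)
       (@id H)) /\
  (forall (H : bijHopfAlgType k) (L : coalgType k)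
          (times' : L ⊗ L -> L) (one : L) (T' : L -> L) (act : L ⊗ H -> L)
          (pi : H -> L) (piV : L -> H),
     is_bijective_cocycle times' one T' act pi ->
     cancel pi piV -> cancel piV pi ->
     is_GV_Hopf_skew_brace
       (fun t : H ⊗ H => tfold (fun h l => piV (times' (pi h ⊗ pi l))) t)
       (fun h => piV (T' (pi h)))).
Proof.
split=> [H times T | H L times' one T' act pi piV].
- exact: cocycle_of_skew_brace.
- exact: skew_brace_of_cocycle.
Qed.
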